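(* Let $R$ be an irreducible reduced (locally finite) root system, let $k$ be a commutative associative unital ring, with $\tfrac12\in k$ if $R$ is of type $C_I$ for some set $I$ with $|I|\ge1$, let $L$ be an $R$-graded Lie algebra over $k$, and let $f:K\to L$ be a $\mathcal Q(R)$-graded central covering. If $0\ne\gamma\in\mathrm{supp}_{\mathcal Q(R)}(K)$, then either (i) $\gamma\in R^\times=R\setminus\{0\}$, in which case $f:K_\gamma\to L_\gamma$ is a bijection, or (ii) $\gamma=\alpha+\beta$ is a degenerate sum, $K_\gamma\subset\ker f$ and $n_\gamma K_\gamma=0$.
   Context: Root system: a pair $(R,E)$, $E$ a vector space over a field of characteristic $0$, $R\subset E$ with $0\in R$, $R$ spanning $E$, $R\cap F$ finite for every finite dimensional subspace $F$, and for every $\alpha\in R^\times$ an $\alpha^\vee\in E^*$ with $\langle\alpha,\alpha^\vee\rangle=2$, $s_\alpha(R)=R$ for $s_\alpha(x)=x-\langle x,\alpha^\vee\rangle\alpha$, and $\langle\beta,\alpha^\vee\rangle\in\mathbb Z$ for all $\alpha,\beta\in R$ ($0^\vee=0$). It is reduced if $\mathbb Z\alpha\cap R\subset\{-\alpha,0,\alpha\}$ for all $\alpha\in R$. $\mathcal Q(R)$ is the $\mathbb Z$-span of $R$. $C_I=\{\pm(\varepsilon_i\pm\varepsilon_j):i\ne j\in I\}\cup\{\pm2\varepsilon_i:i\in I\}\cup\{0\}$; in particular $C_1=A_1$ and $C_2=B_2$. $R$-graded Lie algebra: a Lie $k$-algebra $L$ with a $\mathcal Q(R)$-grading such that (i)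 $L=\bigoplus_{\alpha\in R}L_\alpha$; (ii) for every $\alpha\in R^\times$ there are $e_\alpha\in L_\alpha$, $f_\alpha\in L_{-\alpha}$ such that $h_\alpha=[f_\alpha,e_\alpha]$ satisfies $[h_\alpha,x]=\langle\beta,\alpha^\vee\rangle x$ for all $x\in L_\beta$, $\beta\in R$; (iii) $L_0=\sum_{\alpha\in R^\times}[L_\alpha,L_{-\alpha}]$. A $\mathcal Q(R)$-graded central covering of $L$ is a surjective homomorphism $f:K\to L$ of $\mathcal Q(R)$-graded Lie algebras (preserving degrees) with $K=[K,K]$ and $\ker f$ contained in the centre of $K$. $\mathrm{supp}_{\mathcal Q(R)}(K)=\{\gamma:K_\gamma\ne0\}$. For $0\ne\gamma\in\mathcal Q(R)$, the divisor $n_\gamma$ is the largest positive integer $n$ with $\langle\gamma,\alpha^\vee\rangle\in n\mathbb Z$ for all $\alpha\in R$. A degenerate sum is an element $\gamma=\alpha+\beta$ of $\mathcal Q(R)$ which is a sum of two linearly independent roots $\alpha,\beta\in R$ and has divisor $n_\gamma>1$. *)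

(* Defs.v *)
From HB Require Import structures.
From mathcomp Require Import all_boot all_order all_algebra.
From mathcomp Require Import boolp classical_sets functions cardinality.

Set Implicit Arguments.
Unset Strict Implicit.
Unset Printing Implicit Defensive.

Import GRing.Theory.

Local Open Scope classical_set_scope.
Local Open Scope ring_scope.

(* Possibly infinite-dimensional linear algebra. *)

Definition lspan (k : pzRingType) (V : lmodType k) (S : set V) : set V :=
  [set x | exists (n : nat) (v : 'I_n -> V) (c : 'I_n -> k),
     (forall i, S (v i)) /\ x = \sum_(i < n) c i *: v i].

Definition zspan (V : zmodType) (S : set V) : set V :=
  [set x | exists (n : nat) (v : 'I_n -> V) (c : 'I_n -> int),
     (forall i, S (v i)) /\ x = \sum_(i < n) v i *~ c i].

Definition lin_indep (k : pzRingType) (V : lmodType k) (I : Type)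
    (v : I -> V) : Prop :=
  forall (n : nat) (s : 'I_n -> I) (c : 'I_n -> k), injective s ->
    \sum_(j < n) c j *: v (s j) = 0 -> forall j, c j = 0.

Definition is_submodule (k : pzRingType) (V : lmodType k) (M : set V) : Prop :=
  [/\ M 0, (forall x y, M x -> M y -> M (x + y))
    & (forall (c : k) x, M x -> M (c *: x))].

(* The whole space V is the internal direct sum of the M a, for a in D. *)
Definition is_direct_sum (A : eqType) (V : zmodType) (D : set A)
    (M : A -> set V) : Prop :=
  (forall x, exists (s : seq A) (y : A -> V),
     [/\ (forall a, a \in s -> D a), (forall a, a \in s -> M a (y a))
       & x = \sum_(a <- s) y a])
  /\
  (forall (s : seq A) (y : A -> V), uniq s ->
     (forall a, a \in s -> D a) -> (forall a, a \in s -> M a (y a)) ->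
     \sum_(a <- s) y a = 0 -> forall a, a \in s -> y a = 0).

(* The coroot map is data, but it is determined by the other fields on
   nonzero roots when F has characteristic 0; its values outside rs_roots are
   irrelevant. The finite-dimensional subspaces are the spans of finite
   sequences. *)
Record rootSystem (F : fieldType) (E : lmodType F) := RootSystem {
  rs_roots : set E;
  coroot : E -> {scalar E};
  root0 : rs_roots 0;
  root_span : lspan rs_roots = setT;
  root_locfin : forall s : seq E, finite_set (rs_roots `&` lspan [set` s]);
  coroot0 : forall x, coroot 0 x = 0;
  coroot2 : forall a, rs_roots a -> a <> 0 -> coroot a a = 2%:R;
  root_refl : forall a, rs_roots a -> a <> 0 ->
    [set x - coroot a x *: a | x in rs_roots] = rs_roots;
  root_int : forall a b, rs_roots a -> rs_roots b ->
    exists m : int, coroot a b = m%:~R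
}.

Section RootSystems.
Variables (F : fieldType) (E : lmodType F) (R : rootSystem E).

Definition nzroot : set E := [set a | rs_roots R a /\ a <> 0].

Definition root_lattice : set E := zspan (rs_roots R).

Definition reduced : Prop :=
  forall (a : E) (m : int), rs_roots R a -> rs_roots R (a *~ m) ->
    [\/ a *~ m = - a, a *~ m = 0 | a *~ m = a].

Definition irreducible : Prop :=
  nzroot !=set0 /\
  forall A B : set E, nzroot = A `|` B -> A `&` B = set0 ->
    (forall a b, A a -> B b -> coroot R a b = 0 /\ coroot R b a = 0) ->
    A = set0 \/ B = set0.

(* The set C_I of a family e indexed by I. *)
Definition rootsC (I : Type) (e : I -> E) : set E :=
  [set x | [\/ x = 0,
    (exists i j, i <> j /\
       [\/ x = e i + e j, x = - (e i + e j), x = e i - e j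
         | x = - (e i - e j)])
    | (exists i, x = e i *+ 2 \/ x = - (e i *+ 2))]].

(* A vector space isomorphism from the free vector space on I to E is the
   same as a basis of E indexed by I. *)
Definition is_typeC : Prop :=
  exists (I : Type) (e : I -> E),
    [/\ inhabited I, lin_indep e, lspan (range e) = setT
      & rs_roots R = rootsC e].

Definition divides_root (g : E) (n : nat) : Prop :=
  forall a, rs_roots R a -> exists m : int, coroot R a g = (n%:Z * m)%:~R.

(* The junk value 0 is only taken when no largest n exists; this does not
   happen for nonzero g in the root lattice. *)
Definition divisor (g : E) : nat :=
  xget 0%N [set n | [/\ (0 < n)%N, divides_root g n
    & forall n', (0 < n')%N -> divides_root g n' -> (n' <= n)%N]].

Definition degenerate_sum (g : E) : Prop :=
  (exists a b, [/\ rs_roots R a, rs_roots R b,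
     lin_indep (fun i : bool => if i then a else b) & g = a + b])
  /\ (1 < divisor g)%N.

End RootSystems.

HB.mixin Record isLieAlgebra (k : comPzRingType) L of GRing.Lmodule k L := {
  bracket : L -> L -> L;
  bracket_linearl : forall (c : k) (x y z : L),
    bracket (c *: x + y) z = c *: bracket x z + bracket y z;
  bracket_linearr : forall (c : k) (x y z : L),
    bracket z (c *: x + y) = c *: bracket z x + bracket z y;
  bracketxx : forall x : L, bracket x x = 0;
  bracket_jacobi : forall x y z : L,
    bracket x (bracket y z) + bracket y (bracket z x)
    + bracket z (bracket x y) = 0
}.

#[short(type="lieAlgType")]
HB.structure Definition LieAlgebra (k : comPzRingType) :=
  {L of isLieAlgebra k L & GRing.Lmodule k L}.

Section GradedLie.
Variables (F : fieldType) (E : lmodType F) (R : rootSystem E).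
Variable k : comPzRingType.

Definition lie_center (L : lieAlgType k) : set L :=
  [set z | forall x, bracket z x = 0].

(* A grading by the root lattice is encoded as a family indexed by E which
   vanishes outside the root lattice. *)
Definition lattice_graded (L : lieAlgType k) (Lg : E -> set L) : Prop :=
  [/\ forall g, is_submodule (Lg g),
      forall g, ~ root_lattice R g -> Lg g = [set 0],
      is_direct_sum (root_lattice R) Lg
    & forall g h x y, Lg g x -> Lg h y -> Lg (g + h) (bracket x y)].

Definition supp (L : lieAlgType k) (Lg : E -> set L) : set E :=
  [set g | root_lattice R g /\ Lg g <> [set 0]].

(* The integer m is the pairing of b with the coroot of a, which lives in F
   and so does not act on L directly. *)
Definition root_graded (L : lieAlgType k) (Lg : E -> set L) : Prop :=
  [/\ lattice_graded Lg,
      is_direct_sum (rs_roots R) Lg,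
      (forall a, nzroot R a -> exists e f : L, [/\ Lg a e, Lg (- a) f
         & forall b (x : L) (m : int), rs_roots R b -> Lg b x ->
             coroot R a b = m%:~R -> bracket (bracket f e) x = x *~ m])
    & Lg 0 = lspan [set z | exists a x y,
               [/\ nzroot R a, Lg a x, Lg (- a) y & z = bracket x y]]].

Definition graded_central_covering (K L : lieAlgType k) (Kg : E -> set K)
    (Lg : E -> set L) (f : {linear K -> L}) : Prop :=
  [/\ lattice_graded Kg,
      (forall x y, f (bracket x y) = bracket (f x) (f y))
      /\ (forall g, f @` Kg g `<=` Lg g),
      range f = setT,
      lspan [set z : K | exists x y, z = bracket x y] = setT
    & f @^-1` [set 0] `<=` @lie_center K].

End GradedLie.

(* Main.v *)
From HB Require Import structures.
Require Import Defs.
From mathcomp Require Import all_boot all_order all_algebra zify ring.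
From mathcomp Require Import boolp classical_sets functions cardinality.

(* Elements of K of non-root degree are central, so K_g is spanned by the brackets
   [K_a, K_b] with a, b roots and a + b = g.  Hence the lift of h_c acts on K_g as
   <g, c^v>, and every central element of K_g is killed by all these integers,
   that is, by the divisor of g.  For a root g, or for g = 2 a with a a root, this
   kills the kernel unless all pairings <g, c^v>, respectively <a, c^v>, are even;
   roots with this property exist only in type C, where 2 is invertible. *)

Set Implicit Arguments.
Unset Strict Implicit.
Unset Printing Implicit Defensive.

Import Order.TTheory GRing.Theory Num.Theory.

Local Open Scope classical_set_scope.
Local Open Scope ring_scope.

(** The root system comes with no invariant form and no base, and [E] may have infinite dimension.
    The finiteness of the set of roots in the plane of two given roots takes their place: a product
    of reflections that moved a root forever inside this plane would contradict it. Roots with only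
    even pairings are the long roots of type C, where A_1 counts as C_1. Conversely, the halves of
    such roots, one from each pair of opposites, turn out to be the basis of C_I. The delicate
    degrees are the doubled roots g = 2 a: every pairing of g is even, so centrality alone never
    removes 2-torsion. *)

Lemma intr_char0_inj (F : fieldType) : [pchar F] =i pred0 ->
  injective (fun m : int => m%:~R : F).
Proof.
move=> /pcharf0P char0.
have int0 (n : nat) : (n%:~R : F) = 0 -> n = 0%N.
  by move/eqP; rewrite -pmulrn char0 => /eqP.
move=> m n /eqP; rewrite -subr_eq0 -rmorphB /= => /eqP mn0.
apply/eqP; rewrite -subr_eq0; move: (m - n) mn0 => [d|d] /=.
  by move/int0->.
by rewrite NegzE mulrNz => /eqP; rewrite oppr_eq0 => /eqP/int0.
Qed.

(** * Pairs of roots: constraints from local finiteness *)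

Section RootPairs.
Variables (F : fieldType) (charF : [pchar F] =i pred0).
Variables (E : lmodType F) (R : rootSystem E).
Local Notation cr := (coroot R).
Local Notation inR := (rs_roots R).
Let intrI := intr_char0_inj charF.

Lemma root_reflection a x : nzroot R a -> inR x -> inR (x - cr a x *: a).
Proof. by case=> Ra a0 Rx; rewrite -(root_refl Ra a0); exists x. Qed.

Lemma root_opp a : inR a -> inR (- a).
Proof.
move=> Ra; have [->|/eqP a0] := eqVneq a 0; first by rewrite oppr0; exact: Defs.root0.
have := root_reflection (conj Ra a0) Ra; rewrite coroot2 //.
by congr inR; rewrite scaler_nat mulr2n opprD addNKr.
Qed.

Lemma nzroot_opp a : nzroot R a -> nzroot R (- a).
Proof.
by case=> Ra a0; split; [exact: root_opp|move/eqP; rewrite oppr_eq0 => /eqP].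
Qed.

Lemma root_lattice_root a : inR a -> root_lattice R a.
Proof.
move=> Ra; exists 1%N, (fun=> a), (fun=> 1); split => //.
by rewrite big_ord1.
Qed.

Definition span2 (a b : E) : set E :=
  [set x | exists c d : F, x = c *: a + d *: b].

Lemma span2_lspan a b : span2 a b `<=` lspan [set` [:: a; b]].
Proof.
move=> x [c [d ->]].
exists 2%N, (fun i => nth 0 [:: a; b] i), (fun i => nth 0 [:: c; d] i).
split; last by rewrite big_ord_recl big_ord1.
by move=> i; rewrite /= mem_nth.
Qed.

Lemma finite_roots_span2 a b :
  exists s : seq E, forall x, inR x -> span2 a b x -> x \in s.
Proof.
have /finite_seqP[s sE] := root_locfin R [:: a; b].
exists s => x Rx /span2_lspan xab.
by have : [set` s] x by rewrite -sE.
Qed.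

(** In characteristic 0 the points [a + w *+ n] are pairwise distinct when [w] is nonzero, while the
    plane of [a] and [b] holds only finitely many roots. This is the substitute for positivity of an
    invariant form. *)
Lemma root_string_stationary a b w :
  (forall n, inR (a + w *+ n)) -> span2 a b w -> w = 0.
Proof.
move=> Rw [c [d wE]]; have [s sP] := finite_roots_span2 a b.
apply: contrapT => /eqP w0.
have inj : injective (fun n => a + w *+ n).
  move=> m n /addrI; rewrite -!scaler_nat => /eqP.
  rewrite -subr_eq0 -scalerBl scaler_eq0 (negbTE w0) orbF subr_eq0 => /eqP.
  by rewrite !pmulrn => /intrI [].
pose xs := [seq a + w *+ n | n <- iota 0 (size s).+1].
suff : (size xs <= size s)%N.
  by rewrite size_map size_iota ltnn.
apply: uniq_leq_size; first by rewrite (map_inj_uniq inj) iota_uniq.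
move=> _ /mapP[n _ ->]; apply: sP => //.
exists (1 + c *+ n), (d *+ n); rewrite wE.
by rewrite scalerDl scale1r mulrnDl !scalerMnl addrA.
Qed.

Lemma root_pairing_bounded a b : inR a ->
  exists N : nat, forall x (m : int), inR x -> span2 a b x ->
    cr a x = m%:~R -> (`|m| < N)%N.
Proof.
move=> Ra; have [s sP] := finite_roots_span2 a b.
suff [N NP] : exists N : nat, forall x (m : int), x \in s ->
    cr a x = m%:~R -> (`|m| < N)%N.
  by exists N => x m Rx xab; apply: NP; apply: sP.
elim: s {sP} => [|y s [N NP]]; first by exists 0%N.
have [[m0 ym0]|ny] := pselect (exists m : int, cr a y = m%:~R); last first.
  exists N => x m; rewrite inE => /orP[/eqP-> ym|]; last exact: NP.
  by case: ny; exists m.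
exists (maxn N `|m0|.+1) => x m; rewrite inE => /orP[/eqP->|xs xm].
  by rewrite ym0 => /intrI->; rewrite leq_max ltnSn orbT.
by rewrite leq_max (NP x).
Qed.

Lemma span2_stable a b c d x : span2 a b x -> span2 a b (x - c *: a) /\
  span2 a b (x - d *: b).
Proof.
move=> [u [v ->]]; split; [exists (u - c), v|exists u, (v - d)].
  by rewrite scalerBl addrAC.
by rewrite scalerBl addrA.
Qed.

(* If [`|p * q - 2| > 2], the composite of the two reflections has trace
   [p * q - 2] and determinant 1, so an orbit is unbounded. *)
Lemma root_pairing_trace a b (p q : int) : nzroot R a -> nzroot R b ->
  cr b a = p%:~R -> cr a b = q%:~R -> 0 <= p * q <= 4.
Proof.
move=> Ra Rb pE qE; apply/negPn/negP => pq.
have [N NP] := root_pairing_bounded b Ra.1.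
(* Here [x] runs through the orbit of [a], and [v * q - u] is the next value of [u]. Consecutive
   values satisfy u'' = (p q - 2) u' - u, so with a factor of absolute value at least 3 the strict
   growth of [|u|] reproduces itself, starting from 2 and p q - 2. *)
have grow (n : nat) : exists x (u v : int), [/\ inR x, span2 a b x,
    cr a x = u%:~R, cr b x = v%:~R & (`|u| < `|v * q - u|)%R /\ n%:Z <= `|u|].
  elim: n => [|n [x [u [v [Rx xab xu xv [uv nu]]]]]].
    exists a, 2, p; split => //; first exact: Ra.1.
    - by exists 1, 0; rewrite scale1r scale0r addr0.
    - by rewrite coroot2 //; [exact: Ra.1|exact: Ra.2].
    - by split => //; lia.
  pose y := x - cr b x *: b.
  have Ry : inR y by apply: root_reflection.
  have yu : cr a y = (u - v * q)%:~R.
    by rewrite /y linearB linearZ /= xu xv qE rmorphB rmorphM.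
  have yv : cr b y = (- v)%:~R.
    rewrite /y linearB linearZ /= xv coroot2; [|exact: Rb.1|exact: Rb.2].
    by rewrite rmorphN /=; ring.
  exists (y - cr a y *: a), (v * q - u), (- v - (u - v * q) * p); split.
  - exact: root_reflection.
  - by apply: (span2_stable _ 0 _).1; apply: (span2_stable 0 _ _).2.
  - rewrite linearB linearZ /= yu coroot2; [|exact: Ra.1|exact: Ra.2].
    by rewrite !rmorphB rmorphM /=; ring.
  - by rewrite linearB linearZ /= yu yv pE !(rmorphB, rmorphM, rmorphN) /=; ring.
  - split; last by lia.
    have -> : (- v - (u - v * q) * p) * q - (v * q - u)
      = (p * q - 2) * (v * q - u) - u by ring.
    move: (v * q - u) uv pq => w uw pq.
    have pq3 : (3 <= `|p * q - 2|)%R by lia.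
    have := lerB_dist ((p * q - 2) * w) u.
    rewrite normrM.
    have : 3 * `|w| <= `|p * q - 2| * `|w| by rewrite ler_wpM2r.
    lia.
have [x [u [v [Rx xab xu _ [_ Nu]]]]] := grow N.
have := NP x u Rx xab xu; lia.
Qed.

Lemma root_comb_refl_l a b q c d : nzroot R a -> cr a b = q ->
  inR (c *: a + d *: b) -> inR ((- c - q * d) *: a + d *: b).
Proof.
move=> Ra ab Rx; have := root_reflection Ra Rx; congr inR.
have -> : cr a (c *: a + d *: b) = c * 2%:R + d * q.
  by rewrite linearD !linearZ /= ab coroot2; [|exact: Ra.1|exact: Ra.2].
by rewrite addrAC -scalerBl; congr (_ *: a + _); ring.
Qed.

Lemma root_comb_refl_r a b p c d : nzroot R b -> cr b a = p ->
  inR (c *: a + d *: b) -> inR (c *: a + (- d - p * c) *: b).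
Proof. by move=> Rb ba; rewrite ![c *: a + _]addrC; apply: root_comb_refl_l. Qed.

(** If <b, a^v> = 0, then minus the composite of the two reflections translates by [p *: b] at every
    step, starting from [a]. The resulting string of roots must be stationary, so p = 0. *)
Lemma root_pairing_sym0 a b : nzroot R a -> nzroot R b ->
  cr a b = 0 -> cr b a = 0.
Proof.
move=> Ra Rb ab0; set p := cr b a.
suff : p *: b = 0.
  by move/eqP; rewrite scaler_eq0 => /orP[/eqP//|/eqP b0]; case: Rb.2.
apply: (@root_string_stationary a b); last first.
  by exists 0, p; rewrite scale0r add0r.
suff H n : inR (1 *: a + (p *+ n) *: b).
  by move=> n; rewrite scalerMnl -[a]scale1r.
elim: n => [|n IH].
  by rewrite mulr0n scale0r addr0 scale1r; exact: Ra.1.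
have := root_opp (root_comb_refl_l Ra ab0 (root_comb_refl_r Rb (erefl p) IH)).
rewrite opprD -!scaleNr; congr (inR (_ *: a + _ *: b)); rewrite ?mulrS; ring.
Qed.

(** When p q = 4 the composite of the two reflections is unipotent on the plane: its n-th power
    sends [a] to a + n (2 a - p b). Stationarity gives 2 a = p b with p a divisor of 4. For p = 2 or
    p = -2 this is the claim; otherwise one root is twice the other up to sign, and reducedness
    applies. *)
Lemma root_pairing4 a b (p q : int) : reduced R -> nzroot R a -> nzroot R b ->
  cr b a = p%:~R -> cr a b = q%:~R -> p * q = 4 -> b = a \/ b = - a.
Proof.
move=> redR Ra Rb pE qE pq.
have twoF : (2%:R : F) != 0 by rewrite ((pcharf0P _).1 charF).
pose w := (1 : F) *: a + (- (p%:~R / 2%:R)) *: b.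
have : w *+ 2 = 0.
  apply: (@root_string_stationary a b); last first.
    exists 2%:R, (- p%:~R); rewrite /w scaler_nat scale1r mulrnDl scalerMnl.
    by congr (_ + _ *: _); rewrite -[_ *+ _]mulr_natr mulNr divfK.
  suff H n : inR ((1 + 2%:R *+ n) *: a + (- p%:~R *+ n) *: b).
    move=> n; have := H n; congr inR.
    rewrite scalerDl scale1r -addrA; congr (_ + _).
    have -> : w *+ 2 *+ n = (n%:R * 2%:R) *: w by rewrite -!scaler_nat scalerA.
    rewrite /w scalerDr scale1r scalerA.
    rewrite -[2%:R *+ n]mulr_natl -[_ *+ n]mulr_natl.
    by congr (_ + _ *: _); field.
  elim: n => [|n IH].
    by rewrite !mulr0n scale0r !addr0 scale1r; exact: Ra.1.
  have := root_comb_refl_l Ra qE (root_comb_refl_r Rb pE IH).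
  have pqF : (p%:~R * q%:~R : F) = 4%:R by rewrite -rmorphM /= pq.
  congr (inR (_ *: a + _ *: b)); rewrite ?mulrS; move: pqF.
    by move: (p%:~R) (q%:~R) => u v uv; ring: uv.
  by move: (p%:~R) (q%:~R) => u v uv; ring.
move=> w0; have {w0} ab : a *+ 2 = b *~ p.
  apply/eqP; rewrite -subr_eq0 -[X in _ == X]w0 /w scale1r mulrnDl scalerMnl.
  by rewrite -[X in _ == _ + X *: _]mulr_natr mulNr divfK // scaleNr scaler_int.
have double (x y : E) : x *+ 2 = y *+ 2 -> x = y.
  move/eqP; rewrite -subr_eq0 -mulrnBl -scaler_nat scaler_eq0 (negbTE twoF).
  by rewrite subr_eq0 => /eqP.
have pcase : (p = 1 \/ p = -1) \/ (p = 2 \/ p = -2) \/ (p = 4 \/ p = -4).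
  have [p1|p1] := lerP p (-5); first by case: (lerP q (-1)) => q1; nia.
  have [p2|p2] := lerP 5 p; first by case: (lerP 1 q) => q1; nia.
  have : p = -4 \/ p = -3 \/ p = -2 \/ p = -1 \/ p = 0 \/
    p = 1 \/ p = 2 \/ p = 3 \/ p = 4 by lia.
  by do 8?[case] => pp; move: pq; rewrite pp; lia.
have redS (x y : E) (m : int) : inR x -> inR y -> y <> 0 -> y = x *~ m ->
    x = y \/ x = - y.
  move=> Rx Ry y0 yx; case: (redR x m); rewrite -?yx //.
    by move->; right; rewrite opprK.
  by left.
have [[Ra1 Ra0] [Rb1 Rb0]] := (Ra, Rb).
have symN : b = a \/ b = - a <-> a = b \/ a = - b.
  by split=> -[->|->]; rewrite ?opprK; auto.
case: pcase => [[pp|pp]|[[pp|pp]|[pp|pp]]]; rewrite {}pp in ab.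
- by apply/symN; apply: (redS _ _ 2).
- apply/symN; apply: (redS _ _ (-2)) => //.
  by rewrite mulrNz -pmulrn ab mulrNz opprK.
- by left; apply/esym/double.
- by right; apply/double; rewrite mulNrn ab mulrNz opprK.
- apply: (redS _ _ 2) => //.
  by apply: double; rewrite ab -!pmulrn -mulrnA.
- apply: (redS _ _ (-2)) => //.
  by apply: double; rewrite ab !mulrNz -!pmulrn mulNrn -mulrnA.
Qed.

End RootPairs.

(** * Spans and submodules *)

Section Lspan.
Variables (k : pzRingType) (V : lmodType k).

Lemma lspan_submodule (S : set V) : is_submodule (lspan S).
Proof.
split.
- by exists 0%N, (fun=> 0), (fun=> 0); split=> [[]//|]; rewrite big_ord0.
- move=> _ _ [n [v [c [vS ->]]]] [m [w [d [wS ->]]]].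
  exists (n + m)%N, (fun i => match fintype.split i with inl j => v j | inr j => w j end),
    (fun i => match fintype.split i with inl j => c j | inr j => d j end); split.
    by move=> i; case: fintype.split.
  rewrite big_split_ord /=; congr (_ + _); apply: eq_bigr => i _.
    by rewrite (unsplitK (inl i)).
  by rewrite (unsplitK (inr i)).
- move=> a _ [n [v [c [vS ->]]]]; exists n, v, (fun i => a * c i); split=> //.
  by rewrite scaler_sumr; apply: eq_bigr => i _; rewrite scalerA.
Qed.

Lemma submodule_sum (M : set V) (I : Type) (r : seq I) (P : pred I) (y : I -> V) :
  is_submodule M -> (forall i, P i -> M (y i)) -> M (\sum_(i <- r | P i) y i).
Proof. by case=> M0 MD _ My; elim/big_rec: _ => // i x /My; apply: MD. Qed.

Lemma submodule_opp (M : set V) x : is_submodule M -> M x -> M (- x).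
Proof. by case=> _ _ MZ Mx; rewrite -scaleN1r; apply: MZ. Qed.

Lemma sub_lspan (S : set V) : S `<=` lspan S.
Proof.
move=> x Sx; exists 1%N, (fun=> x), (fun=> 1); split=> //.
by rewrite big_ord1 scale1r.
Qed.

Lemma lspan_min (S M : set V) : is_submodule M -> S `<=` M -> lspan S `<=` M.
Proof.
move=> subM SM _ [n [v [c [vS ->]]]]; apply: submodule_sum => // i _.
by case: subM => _ _; apply; apply: SM.
Qed.

End Lspan.

(** * Roots with even pairings and the recognition of type C *)

Section EvenRoots.
Variables (F : fieldType) (charF : [pchar F] =i pred0).
Variables (E : lmodType F) (R : rootSystem E) (redR : reduced R).
Local Notation cr := (coroot R).
Local Notation inR := (rs_roots R).
Let intrI := intr_char0_inj charF.

Let two_neq0 : (2%:R : F) != 0.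
Proof. by rewrite ((pcharf0P _).1 charF). Qed.

Let half_double (x : E) : 2%:R^-1 *: x + 2%:R^-1 *: x = x.
Proof. by rewrite -mulr2n -scaler_nat scalerA divff // scale1r. Qed.

Lemma nzroot_pairing2 a : nzroot R a -> cr a a = 2%:R.
Proof. by case=> Ra a0; apply: coroot2. Qed.

Lemma root_pairing_le3 a b (p q : int) : nzroot R a -> nzroot R b ->
  cr b a = p%:~R -> cr a b = q%:~R -> [\/ b = a, b = - a | 0 <= p * q <= 3].
Proof.
move=> Ra Rb pE qE; have := root_pairing_trace charF Ra Rb pE qE.
have [pq _|pq pq4] := eqVneq (p * q) 4.
  by case: (root_pairing4 charF redR Ra Rb pE qE pq); [constructor 1|constructor 2].
by constructor 3; lia.
Qed.

(** Pairing a relation A a + B b = 0 with both coroots gives a linear system of determinant 4 - p q,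
    which is not zero. *)
Lemma root_lin_indep a b : nzroot R a -> nzroot R b -> b <> a -> b <> - a ->
  lin_indep (fun i : bool => if i then a else b).
Proof.
move=> Ra Rb ba bNa n s c injs sum0 j.
have [p pE] := root_int Rb.1 Ra.1; have [q qE] := root_int Ra.1 Rb.1.
have pq4 : (4%:R - p%:~R * q%:~R : F) != 0.
  case: (root_pairing_le3 Ra Rb pE qE) => // pq.
  rewrite subr_eq0 -rmorphM; apply/eqP => /(@intrI 4) pq4.
  by rewrite -pq4 in pq.
(* Since [s] is injective into [bool], each of the sums [A] and [B] below has at most one term. *)
have coef (i : 'I_n) : \sum_(j | s j == s i) c j = c i.
  rewrite (bigD1 i) //= big1 ?addr0 // => l /andP[/eqP/injs->].
  by rewrite eqxx.
pose A := \sum_(j | s j) c j; pose B := \sum_(j | ~~ s j) c j.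
have AB : A *: a + B *: b = 0.
  rewrite -sum0 (bigID s) /= !scaler_suml; congr (_ + _).
    by apply: eq_bigr => i ->.
  by apply: eq_bigr => i /negbTE->.
have Ea : A * 2%:R + B * q%:~R = 0.
  by rewrite -(nzroot_pairing2 Ra) -qE -!linearZ -linearD AB linear0.
have Eb : A * p%:~R + B * 2%:R = 0.
  by rewrite -(nzroot_pairing2 Rb) -pE -!linearZ -linearD AB linear0.
have A0 : A = 0.
  apply/(mulfI pq4); rewrite mulr0; transitivity
    (2%:R * (A * 2%:R + B * q%:~R) - q%:~R * (A * p%:~R + B * 2%:R)); first by ring.
  by rewrite Ea Eb !mulr0 subr0.
have B0 : B = 0.
  apply/(mulfI pq4); rewrite mulr0; transitivity
    (2%:R * (A * p%:~R + B * 2%:R) - p%:~R * (A * 2%:R + B * q%:~R)); first by ring.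
  by rewrite Ea Eb !mulr0 subr0.
rewrite -coef; case sj: (s j); first by rewrite -[RHS]A0; apply: eq_bigl => i; rewrite eqb_id.
by rewrite -[RHS]B0; apply: eq_bigl => i; rewrite eqbF_neg.
Qed.

(** This makes the divisor of [a + b] meaningful. If all pairings vanished, [a] and [b] would pair
    to -2 both ways; the product 4 leaves only b = a, which pairs to 2 instead. *)
Lemma root_sum_pairing a b : nzroot R a -> nzroot R b -> b <> - a ->
  exists2 c, nzroot R c & cr c (a + b) <> 0.
Proof.
move=> Ra Rb bNa; apply: contrapT => noc.
have ab0 c : nzroot R c -> cr c a + cr c b = 0.
  by move=> Rc; apply: contrapT; rewrite -linearD => ab; apply: noc; exists c.
have two (x : F) : 2%:R + x = 0 -> x = (- 2)%:~R.
  by move/(canRL (addKr _))->; rewrite addr0 rmorphN.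
have qE := ab0 a Ra; rewrite nzroot_pairing2 // in qE; move/two in qE.
have pE := ab0 b Rb; rewrite nzroot_pairing2 // addrC in pE; move/two in pE.
case: (root_pairing4 charF redR Ra Rb pE qE) => // ba.
by move: qE; rewrite ba nzroot_pairing2 // => /(@intrI 2).
Qed.

(** In type C these are exactly the long roots, 2 e_i and their opposites. *)
Definition evenroot (d : E) : Prop := nzroot R d /\ divides_root R d 2.

Lemma evenroot_opp d : evenroot d -> evenroot (- d).
Proof.
move=> [Rd d2]; split; first exact: nzroot_opp.
move=> b Rb; have [m mE] := d2 b Rb; exists (- m).
by rewrite linearN /= mE mulrN rmorphN.
Qed.

Lemma evenroot_refl d b : evenroot d -> nzroot R b ->
  evenroot (d - cr b d *: b).
Proof.
move=> [Rd d2] Rb; have [m mE] := d2 b Rb.1.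
have Rx := root_reflection Rb Rd.1; split.
  split=> // x0; have := congr1 (cr b) x0.
  rewrite linearB linearZ linear0 /= nzroot_pairing2 // => db.
  have db0 : cr b d = 0 by apply/eqP; rewrite -oppr_eq0 -db; apply/eqP; ring.
  by move: x0; rewrite db0 scale0r subr0; apply: Rd.2.
move=> a Ra; have [n nE] := d2 a Ra; have [l lE] := root_int Ra Rb.1.
exists (n - m * l); rewrite linearB linearZ /= nE mE lE -rmorphM -rmorphB /=.
by congr _%:~R; ring.
Qed.

(** Write 2 m and q for the two pairings. Both are nonzero, by symmetry of orthogonality, and 2 m q
    is at most 3 unless [b] is [d] or [- d]; hence m q = 1. *)
Lemma evenroot_pairing d b : evenroot d -> nzroot R b -> cr d b <> 0 ->
  [\/ b = d, b = - d, cr d b = 1 /\ cr b d = 2%:R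
    | cr d b = - 1 /\ cr b d = - 2%:R].
Proof.
move=> [Rd d2] Rb db; have [q qE] := root_int Rd.1 Rb.1.
have [m mE] := d2 b Rb.1.
case: (root_pairing_le3 Rd Rb mE qE) => [->|->|pq];
  [by constructor 1|by constructor 2|].
have q0 : q <> 0 by move=> q0; apply: db; rewrite qE q0.
have m0 : m <> 0.
  move=> m0; apply: db; apply: (root_pairing_sym0 charF Rb Rd).
  by rewrite mE m0 mulr0.
have mq : m * q = 1 by nia.
have [[mm qq]|[mm qq]] : (m = 1 /\ q = 1) \/ (m = -1 /\ q = -1) by nia.
  by constructor 3; rewrite mE qE mm qq.
by constructor 4; rewrite mE qE mm qq.
Qed.

(** A nonzero pairing would be 1 or -1, but it is even because [e] is an even root. *)
Lemma evenroot_orthogonal d e : evenroot d -> evenroot e -> e <> d -> e <> - d ->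
  cr d e = 0.
Proof.
move=> ed [Re e2] ned neNd; apply: contrapT => de.
have [m mE] := e2 d ed.1.1.
case: (evenroot_pairing ed Re de) => // -[]; rewrite mE.
  by move/(@intrI _ 1); lia.
by move/(@intrI _ (-1)); lia.
Qed.

(** The reflection of [d] in [b] is again even and equals d - 2 b or d + 2 b. Solving for [b] writes
    it as half the sum of two even roots; if these coincide, [b] is [d] or [- d], and they cannot be
    opposite as [b] is nonzero. *)
Lemma evenroot_half_sum d b : evenroot d -> nzroot R b -> cr d b <> 0 ->
  [\/ b = d, b = - d | exists d1 d2, [/\ d1 = d \/ d1 = - d, evenroot d2,
      d2 <> d1, d2 <> - d1 & b = 2%:R^-1 *: (d1 + d2)]].
Proof.
move=> ed Rb db.
have b0 (x y : E) : b = 2%:R^-1 *: (x + y) -> y <> - x.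
  by move=> bxy yx; apply: Rb.2; rewrite bxy yx subrr scaler0.
have := evenroot_refl ed Rb.
have bd (x y : E) : b = 2%:R^-1 *: (x + y) -> y = x -> b = x.
  by move=> -> ->; rewrite scalerDr half_double.
case: (evenroot_pairing ed Rb db) => [->|->|[_ ->]|[_ ->]] er;
  [by constructor 1|by constructor 2| |].
  have bE : b = 2%:R^-1 *: (d + - (d - 2%:R *: b)).
    by rewrite opprB addrCA subrr addr0 scalerA mulVf // scale1r.
  have [eqd|ned] := pselect (- (d - 2%:R *: b) = d).
    by constructor 1; apply: bd bE eqd.
  constructor 3; exists d, (- (d - 2%:R *: b)); split=> //; first by left.
    exact: evenroot_opp.
  exact: b0 bE.
have bE : b = 2%:R^-1 *: (- d + (d - (- 2%:R) *: b)).
  by rewrite addKr scaleNr opprK scalerA mulVf // scale1r.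
have [eqd|ned] := pselect (d - (- 2%:R) *: b = - d).
  by constructor 2; apply: bd bE eqd.
constructor 3; exists (- d), (d - (- 2%:R) *: b); split=> //; first by right.
exact: b0 bE.
Qed.

(** For long roots 2 e_i and 2 e_j this asks that e_i + e_j be a root. The cases [e = d] and
    [e = - d] are added to obtain an equivalence relation compatible with signs. *)
Definition linked (d e : E) : Prop := [/\ evenroot d, evenroot e
  & [\/ e = d, e = - d | inR (2%:R^-1 *: (d + e))]].

(** The reflection in [e] carries (d + e) / 2 to (d - e) / 2. *)
Lemma linked_oppr d e : linked d e -> linked d (- e).
Proof.
move=> [ed ee de]; split=> //; first exact: evenroot_opp.
case: de => [->|->|Rde]; [by constructor 2|by constructor 1; rewrite opprK|].
have [->|ned] := pselect (d = e); first by constructor 2.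
have [->|neNd] := pselect (d = - e); first by constructor 1.
have := root_reflection ee.1 Rde.
have -> : cr e (2%:R^-1 *: (d + e)) = 1.
  rewrite linearZ linearD /= evenroot_orthogonal // add0r nzroot_pairing2 ?mulVf //.
  exact: ee.1.
rewrite scale1r => Rx; constructor 3; move: Rx; congr inR.
by rewrite !scalerDr scalerN -[e in X in _ - X]half_double opprD addrA addrK.
Qed.

Lemma linked_sym d e : linked d e -> linked e d.
Proof.
case=> ed ee de; split=> //; case: de => [->|->|].
- by constructor 1.
- by constructor 2; rewrite opprK.
- by constructor 3; rewrite addrC.
Qed.

Lemma linked_oppl d e : linked d e -> linked (- d) e.
Proof. by move=> /linked_sym/linked_oppr/linked_sym. Qed.

(** In the generic case (e - c) / 2 is a root, and the reflection in it carries (d + e) / 2 to (d +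
    c) / 2. *)
Lemma linked_trans d e c : linked d e -> linked e c -> linked d c.
Proof.
move=> de ec.
have [ed|ned] := pselect (e = d); first by rewrite -ed.
have [->//|nec] := pselect (c = e).
have [->|neNc] := pselect (c = - e); first exact: linked_oppr.
have [eNd|neNd] := pselect (e = - d).
  by move: (linked_oppl ec); rewrite eNd opprK.
case: (de) => ed ee [//|//|Rde]; case: (linked_oppr ec) => _ _.
have ec' : evenroot c by case: ec.
case=> [Nce|/oppr_inj//|Rec]; first by case: neNc; rewrite -Nce opprK.
split=> //; have [->|ncd] := pselect (c = d); first by constructor 1.
have [->|ncNd] := pselect (c = - d); first by constructor 2.
constructor 3; pose y := 2%:R^-1 *: (e - c).
have ce0 : cr e c = 0 by apply: evenroot_orthogonal.
have Ry : nzroot R y.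
  split=> // y0; have := congr1 (cr e) y0.
  rewrite /y linearZ linearB /= ce0 subr0 nzroot_pairing2; last exact: ee.1.
  by rewrite linear0 mulVf // => /eqP; rewrite oner_eq0.
have ey : cr e y = 1.
  rewrite /y linearZ linearB /= ce0 subr0 nzroot_pairing2 ?mulVf //; exact: ee.1.
have ye : cr y e = 2%:R.
  have [|yE|yE|[]//|[]] := evenroot_pairing ee Ry.
  - by rewrite ey; apply/eqP/oner_neq0.
  - by move: (nzroot_pairing2 Ry); rewrite yE.
  - move: ey; rewrite yE linearN /= nzroot_pairing2; last exact: ee.1.
    by move/(@intrI (-2) 1).
  - by rewrite ey => /(@intrI 1 (-1)).
have yd : cr y d = 0.
  apply: (root_pairing_sym0 charF ed.1 Ry).
  rewrite /y linearZ linearB /= !evenroot_orthogonal ?subrr ?mulr0 //.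
have := root_reflection Ry Rde.
have -> : cr y (2%:R^-1 *: (d + e)) = 1 by rewrite linearZ linearD /= ye yd add0r mulVf.
rewrite scale1r; congr inR.
by rewrite /y -scalerBr; congr (_ *: _); rewrite opprB addrACA subrr addr0.
Qed.

(** Irreducibility is applied to the roots not orthogonal to the class of [d0] and to the remaining
    ones. A root of the first kind is, up to sign, in the class or half the sum of two of its
    members, hence orthogonal to every root of the second kind. *)
Lemma root_linked_evenroot d0 b : irreducible R -> evenroot d0 -> nzroot R b ->
  exists2 e, linked d0 e & cr e b <> 0.
Proof.
move=> [_ irr] ed0 Rb; apply: contrapT => nob.
have dd0 : linked d0 d0 by split=> //; constructor 1.
pose A : set E := [set x | nzroot R x /\ exists2 e, linked d0 e & cr e x <> 0].
pose B : set E := [set x | nzroot R x /\ forall e, linked d0 e -> cr e x = 0].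
case: (irr A B).
- apply/seteqP; split=> x; last by case=> -[].
  move=> Rx; have [ex|nex] := pselect (exists2 e, linked d0 e & cr e x <> 0).
    by left.
  right; split=> // e de; apply: contrapT => ex; apply: nex.
  by exists e.
- by apply/seteqP; split=> // x [[_ [e de ex]] [_ /(_ e de)]].
- move=> x y [Rx [e de ex]] [Ry yB].
  suff yx : cr y x = 0 by split=> //; apply: (root_pairing_sym0 charF).
  have yl c : linked d0 c -> cr y c = 0.
    move=> dc; have [_ [Rc _] _] := dc.
    by apply: (root_pairing_sym0 charF Rc Ry); apply: yB.
  have [_ ee _] := de.
  case: (evenroot_half_sum ee Rx ex) => [->|->|[d1 [d2 [d1e ed2 ne neN xE]]]].
  + exact: yl.
  + by rewrite linearN /= yl ?oppr0.
  + have dd1 : linked d0 d1 by case: d1e => ->//; apply: linked_oppr.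
    have dd2 : linked d0 d2.
      apply: (linked_trans dd1); split=> //; first by case: dd1.
      by constructor 3; rewrite -xE; exact: Rx.1.
    by rewrite xE linearZ linearD /= !yl // addr0 mulr0.
- move=> A0; have : A d0.
    split; first exact: ed0.1.
    exists d0 => //; rewrite nzroot_pairing2; last exact: ed0.1.
    exact/eqP.
  by rewrite A0.
- move=> B0; have : B b.
    by split=> // e de; apply: contrapT => eb; apply: nob; exists e.
  by rewrite B0.
Qed.

Lemma evenroots_linked d e : irreducible R -> evenroot d -> evenroot e -> linked d e.
Proof.
move=> irr ed ee; have [c dc ce] := root_linked_evenroot irr ed ee.1.
have [_ ec _] := dc.
have [->//|ne] := pselect (e = c).
have [->|neN] := pselect (e = - c); first exact: linked_oppr.
by case: ce; apply: evenroot_orthogonal.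
Qed.

(** The result of [choose] depends only on the extension of the predicate, so [x] and [- x] receive
    the same representative; no ordering of the roots is needed. *)
Definition up_to_sign (x : E) : E := choose [pred y | (y == x) || (y == - x)] x.

Lemma up_to_signP x : up_to_sign x = x \/ up_to_sign x = - x.
Proof.
have : [pred y | (y == x) || (y == - x)] (up_to_sign x).
  by apply: chooseP; rewrite /= eqxx.
by case/orP => /eqP; auto.
Qed.

Lemma up_to_signN x : up_to_sign (- x) = up_to_sign x.
Proof.
rewrite /up_to_sign; under eq_choose do rewrite /= opprK orbC.
by apply: choose_id; rewrite /= eqxx ?orbT.
Qed.

(** The index set is the set of chosen representatives of the even roots up to sign, and e_i is half
    of the i-th one. Orthogonality makes the e_i independent, linkedness makes all e_i + e_j and e_i
    - e_j with i, j distinct roots, and the half-sum description shows that no other roots occur. *)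
Lemma evenroot_typeC : irreducible R -> (exists d, evenroot d) -> is_typeC R.
Proof.
move=> irr [d0 ed0].
pose I := {d : E | evenroot d /\ up_to_sign d = d}.
pose v (i : I) : E := sval i.
have vE i : evenroot (v i) by case: i => x [].
have vI i j : v i = v j -> i = j.
  by case: i j => [x px] [y py] /= xy; apply: eq_exist.
have vN i j : v i <> - v j.
  move=> vij; have ij : i = j.
    apply: vI; case: (i) (j) vij => [x [ex sx]] [y [ey sy]] /= xy.
    by rewrite /v /= -sx -sy xy up_to_signN.
  move: vij; rewrite {}ij => /eqP; rewrite -addr_eq0 -mulr2n -scaler_nat.
  by rewrite scaler_eq0 (negbTE two_neq0) => /eqP; case: (vE j) => -[].
have vsurj d : evenroot d -> exists i, d = v i \/ d = - v i.
  move=> ed; have eu : evenroot (up_to_sign d) /\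
      up_to_sign (up_to_sign d) = up_to_sign d.
    case: (up_to_signP d) => dE; rewrite {1}dE; split=> //.
    - by rewrite dE.
    - exact: evenroot_opp.
    - by rewrite {1}dE up_to_signN.
  exists (exist (fun x => evenroot x /\ up_to_sign x = x) _ eu); rewrite /v /=.
  by case: (up_to_signP d) => ->; rewrite ?opprK; auto.
pose e i := 2%:R^-1 *: v i.
have e2 i : e i *+ 2 = v i by rewrite mulr2n half_double.
have half_root i j : i <> j -> inR (e i + e j).
  move=> ij; rewrite -scalerDr.
  case: (evenroots_linked irr (vE i) (vE j)) => _ _ [/vI/esym//|/vN//|//].
have half_rootB i j : i <> j -> inR (e i - e j).
  move=> ij; rewrite -scalerBr.
  case: (linked_oppr (evenroots_linked irr (vE i) (vE j))) => _ _ [| |//].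
    by move/esym/vN.
  by move/oppr_inj/vI/esym.
have vv i j : i <> j -> cr (v i) (v j) = 0.
  by move=> ij; apply: evenroot_orthogonal => // /vI/esym.
have rootsE : inR = rootsC e.
  apply/seteqP; split=> x.
    move=> Rx; have [->|/eqP x0] := eqVneq x 0; first by constructor 1.
    have [d dd dx] := root_linked_evenroot irr ed0 (conj Rx x0).
    have [_ ed _] := dd.
    have [i di] := vsurj d ed.
    case: (evenroot_half_sum ed (conj Rx x0) dx) => [->|->|].
    - by constructor 3; exists i; rewrite e2.
    - by constructor 3; exists i; rewrite e2; case: di => ->; rewrite ?opprK; auto.
    move=> [d1 [d2 [d1d ed2 ne neN xE]]]; have [j dj] := vsurj d2 ed2.
    have d1i : d1 = v i \/ d1 = - v i.
      by case: d1d di => -> [] ->; rewrite ?opprK; auto.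
    constructor 2; exists i, j; split.
      move=> ij; case: d1i dj => [d1E|d1E] [d2E|d2E]; move: ne neN;
        by rewrite d1E d2E ij ?opprK.
    case: d1i dj xE => -> [] -> ->; rewrite scalerDr ?scalerN -/(e i) -/(e j).
    - by constructor 1.
    - by constructor 3.
    - by constructor 4; rewrite opprB addrC.
    - by constructor 2; rewrite opprD.
  case=> [->|[i [j [ij]]]|[i]]; first exact: Defs.root0.
    case=> ->; try apply: root_opp; [exact: half_root|exact: half_root| |];
      exact: half_rootB.
  by rewrite e2 => -[] ->; [|apply: root_opp]; case: (vE i) => -[].
have [i0 _] := vsurj d0 ed0.
exists I, e; split=> //.
- move=> n s c injs sum0 j.
  have := congr1 (cr (v (s j))) sum0; rewrite linear0 linear_sum (bigD1 j) //=.
  rewrite big1 => [|l lj].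
    rewrite addr0 !linearZ /= nzroot_pairing2; last by case: (vE (s j)).
    by rewrite mulVf // mulr1.
  rewrite !linearZ /= vv ?mulr0 // => /injs jl.
  by rewrite jl eqxx in lj.
- rewrite -subTset -(root_span R); apply: lspan_min; first exact: lspan_submodule.
  have [S0 SD SZ] := lspan_submodule (range e).
  have Se i : lspan (range e) (e i) by apply: sub_lspan; exists i.
  have SN x : lspan (range e) x -> lspan (range e) (- x).
    by apply: submodule_opp.
  move=> x; rewrite /= rootsE => -[->//|[i [j [_]]]|[i]].
    by case=> ->; try apply: (SN); apply: SD => //; apply: SN.
  by rewrite mulr2n => -[] ->; try apply: (SN); apply: SD.
Qed.

End EvenRoots.

(** * Identities for the Lie bracket *)

Section Bracket.
Variables (k : comPzRingType) (L : lieAlgType k).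
Implicit Types x y z : L.

HB.instance Definition _ x :=
  @GRing.isLinear.Build k L L *:%R (bracket x)
    (fun c y z => bracket_linearr c y z x).

Lemma bracketC x y : bracket x y = - bracket y x.
Proof.
have Dl u v w : bracket (u + v) w = bracket u w + bracket v w :> L.
  by rewrite -[u]scale1r bracket_linearl !scale1r.
apply/eqP; rewrite -addr_eq0; apply/eqP; have := bracketxx (x + y).
by rewrite Dl !linearD /= !bracketxx add0r addr0.
Qed.

Lemma bracketDl x y z : bracket (x + y) z = bracket x z + bracket y z.
Proof. by rewrite ![bracket _ z]bracketC linearD opprD. Qed.

Lemma bracketZl c x z : bracket (c *: x) z = c *: bracket x z.
Proof. by rewrite ![bracket _ z]bracketC linearZ scalerN. Qed.

Lemma bracketMzl x m z : bracket (x *~ m) z = bracket x z *~ m.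
Proof. by rewrite ![bracket _ z]bracketC raddfMz mulNrz. Qed.

Lemma bracket0l z : bracket 0 z = 0 :> L.
Proof. by rewrite bracketC linear0 oppr0. Qed.

Lemma bracket_suml (I : Type) (r : seq I) (F : I -> L) z :
  bracket (\sum_(i <- r) F i) z = \sum_(i <- r) bracket (F i) z.
Proof.
elim: r => [|i r IH]; first by rewrite !big_nil bracket0l.
by rewrite !big_cons bracketDl IH.
Qed.

Lemma bracketA x y z :
  bracket x (bracket y z) = bracket (bracket x y) z + bracket y (bracket x z).
Proof.
have := bracket_jacobi x y z; rewrite -addrA => /eqP; rewrite addr_eq0 => /eqP->.
by rewrite opprD addrC -bracketC [bracket z x]bracketC linearN opprK.
Qed.

Lemma bracket_bracketl x y z :
  bracket (bracket x y) z = bracket x (bracket y z) - bracket y (bracket x z).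
Proof. by rewrite bracketA addrK. Qed.

End Bracket.

(** * Homogeneous components in a direct sum *)

Section DirectSum.
Variables (k : pzRingType) (V : lmodType k) (A : choiceType).
Variables (D : set A) (M : A -> set V).
Hypothesis subM : forall a, is_submodule (M a).

Lemma direct_sum_decomposition x : is_direct_sum D M ->
  exists s : seq (A * V), (forall p, p \in s -> D p.1 /\ M p.1 p.2) /\
    x = \sum_(p <- s) p.2.
Proof.
move=> [ex _]; have [s [y [sD sM ->]]] := ex x.
exists [seq (a, y a) | a <- s]; split; last by rewrite big_map.
by move=> p /mapP[a sa ->]; split; [apply: sD|apply: sM].
Qed.

Lemma direct_sum_component g (s : seq (A * V)) : is_direct_sum D M ->
  D g -> M g (\sum_(p <- s) p.2) ->
  (forall p, p \in s -> D p.1 /\ M p.1 p.2) ->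
  \sum_(p <- s) p.2 = \sum_(p <- s | p.1 == g) p.2.
Proof.
move=> [_ uniqM] Dg; set x := \sum_(p <- s) p.2 => Mx sP.
pose u := undup (g :: [seq p.1 | p <- s]).
(* Degrees may repeat in [s], whereas uniqueness concerns duplicate-free lists, so terms of equal
   degree are collected. Subtracting [x] in degree [g] makes the total zero; [g] was put into [u] in
   case no term has that degree. *)
pose y a := \sum_(p <- s | p.1 == a) p.2 - (if a == g then x else 0).
have uu : uniq u by apply: undup_uniq.
have gu : g \in u by rewrite mem_undup mem_head.
have one a (z : V) : a \in u -> \sum_(b <- u | a == b) z = z.
  move=> au; rewrite -big_filter.
  suff -> : [seq b <- u | a == b] = [:: a] by rewrite big_seq1.
  by rewrite (@eq_filter _ _ (pred1 a)) ?filter_pred1_uniq // => b /=; rewrite eq_sym.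
suff : y g = 0 by rewrite /y eqxx => /eqP; rewrite subr_eq0 => /eqP.
apply: (uniqM u) => //.
- move=> a; rewrite mem_undup inE => /orP[/eqP->//|/mapP[p ps ->]].
  by case: (sP p ps).
- move=> a _; case: (subM a) => _ MD _; apply: MD.
    rewrite big_seq_cond; apply: submodule_sum => // p /andP[ps /eqP<-].
    by case: (sP p ps).
  apply: submodule_opp => //; case: eqP => [->//|_].
  by case: (subM a).
- rewrite sumrB (exchange_big_dep predT) //= -big_mkcond /=.
  rewrite (eq_bigl (fun i => g == i)); last by move=> i; rewrite eq_sym.
  rewrite one // [X in X - _](_ : _ = x) ?subrr // /x !big_seq.
  apply: eq_bigr => p ps; apply: one.
  by rewrite mem_undup inE map_f ?orbT.
Qed.

End DirectSum.

(** * Central coverings: generation by root spaces and torsion of the kernel *)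

Section Covering.
Variables (F : fieldType) (charF : [pchar F] =i pred0).
Variables (E : lmodType F) (R : rootSystem E).
Variables (k : comPzRingType) (L : lieAlgType k) (Lg : E -> set L).
Variables (K : lieAlgType k) (Kg : E -> set K) (f : {linear K -> L}).
Hypotheses (gradL : root_graded R Lg) (covf : graded_central_covering R Kg Lg f).
Local Notation cr := (coroot R).
Local Notation inR := (rs_roots R).

Let subK g : is_submodule (Kg g).
Proof. by case: covf => -[]. Qed.

Let subL g : is_submodule (Lg g).
Proof. by case: gradL => -[]. Qed.

Let directK : is_direct_sum (root_lattice R) Kg.
Proof. by case: covf => -[]. Qed.

Let directL : is_direct_sum (root_lattice R) Lg.
Proof. by case: gradL => -[]. Qed.

Let Kg_bracket g h x y : Kg g x -> Kg h y -> Kg (g + h) (bracket x y).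
Proof. by case: covf => -[_ _ _ KK] *; apply: KK. Qed.

Let Kg_lattice g x : ~ root_lattice R g -> Kg g x -> x = 0.
Proof. by case: covf => -[_ K0 _ _] _ _ _ _ ng; rewrite K0. Qed.

Lemma covering_degree g x : Kg g x -> Lg g (f x).
Proof. by case: covf => _ [_ fKL] *; apply: (fKL g); exists x. Qed.

Lemma covering_central x y : f x = 0 -> bracket x y = 0.
Proof. by case: covf => _ _ _ _ cen fx0; apply: cen. Qed.

(** A decomposition of [y] along the roots is also one along the lattice, and it has no term of
    degree [g]. *)
Lemma grading_support g y : root_lattice R g -> ~ inR g -> Lg g y -> y = 0.
Proof.
move=> Qg nRg Ly; have [_ dR _ _] := gradL.
have [s [sP yE]] := direct_sum_decomposition y dR.
rewrite yE (@direct_sum_component _ _ _ _ _ subL g s directL) // -?yE //.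
  by rewrite big_seq_cond big1 // => p /andP[/sP[Rp _] /eqP pg]; rewrite pg in Rp.
by move=> p /sP[Rp Mp]; split=> //; apply: root_lattice_root.
Qed.

Lemma covering_nonroot g x : ~ inR g -> Kg g x -> f x = 0.
Proof.
move=> nRg Kx; have [Qg|nQg] := pselect (root_lattice R g).
  exact: grading_support (covering_degree Kx).
by rewrite (Kg_lattice nQg Kx) linear0.
Qed.

Lemma covering_surj g y : root_lattice R g -> Lg g y -> exists2 x, Kg g x & f x = y.
Proof.
move=> Qg Ly; have [_ _ fT _ _] := covf.
have [x _ xy] : range f y by rewrite fT.
have [s [sP xE]] := direct_sum_decomposition x directK.
exists (\sum_(p <- s | p.1 == g) p.2).
  rewrite big_seq_cond; apply: submodule_sum => // p /andP[ps /eqP<-].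
  by case: (sP p ps).
have fE : \sum_(q <- [seq (p.1, f p.2) | p <- s]) q.2 = y.
  by rewrite big_map /= -xy xE linear_sum.
rewrite linear_sum -[RHS]fE (@direct_sum_component _ _ _ _ _ subL g _ directL) ?fE //.
  by rewrite big_map.
by move=> _ /mapP[p /sP[Qp Kp] ->]; split=> //=; apply: covering_degree.
Qed.

(** The form of an induction principle lets [S] be an eigenspace in one application and 0 in
    another. *)
Lemma covering_ind g (S : set K) : root_lattice R g -> is_submodule S ->
  (forall a b y z, inR a -> inR b -> Kg a y -> Kg b z -> a + b = g ->
     S (bracket y z)) ->
  Kg g `<=` S.
Proof.
move=> Qg subS SB.
(* A spanning bracket of K = [K, K] need not be homogeneous, so the claim is extended to all
   degrees: [T] collects the sums of homogeneous terms whose terms of degree [g] lie in [S]. It is a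
   submodule containing every bracket, hence all of [K]. *)
pose T := [set x | exists s : seq (E * K),
  (forall p, p \in s -> [/\ root_lattice R p.1, Kg p.1 p.2 & p.1 = g -> S p.2])
  /\ x = \sum_(p <- s) p.2].
have subT : is_submodule T.
  split.
  - by exists [::]; rewrite big_nil.
  - move=> _ _ [s [sP ->]] [t [tP ->]]; exists (s ++ t); rewrite big_cat.
    by split=> // p; rewrite mem_cat => /orP[/sP|/tP].
  - move=> c _ [s [sP ->]]; exists [seq (p.1, c *: p.2) | p <- s].
    split; last by rewrite big_map scaler_sumr.
    move=> _ /mapP[p /sP[Qp Kp Sp] ->]; split=> //=.
      by case: (subK p.1) => _ _; apply.
    by move=> pg; case: subS => _ _; apply; apply: Sp.
have TT x : T x.
  have [_ _ _ KT _] := covf.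
  have : lspan [set z : K | exists x y, z = bracket x y] x by rewrite KT.
  apply: lspan_min => // _ [y [z ->]].
  have [s [sP ->]] := direct_sum_decomposition y directK.
  have [t [tP ->]] := direct_sum_decomposition z directK.
  rewrite bracket_suml big_seq; apply: submodule_sum => // p /sP[Qp Kp].
  rewrite linear_sum /= big_seq; apply: submodule_sum => // q /tP[Qq Kq].
  have Kpq := Kg_bracket Kp Kq.
  have [Qpq|nQ] := pselect (root_lattice R (p.1 + q.1)); last first.
    by rewrite (Kg_lattice nQ Kpq); case: subT.
  exists [:: (p.1 + q.1, bracket p.2 q.2)]; rewrite big_seq1; split=> // r.
  rewrite inE => /eqP->; split=> //= pqg.
  have [Rp|nRp] := pselect (inR p.1); last first.
    by rewrite covering_central ?(covering_nonroot nRp Kp) //; case: subS.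
  have [Rq|nRq] := pselect (inR q.1); last first.
    rewrite bracketC covering_central ?(covering_nonroot nRq Kq) // oppr0.
    by case: subS.
  exact: SB pqg.
move=> x Kx; have [s [sP xE]] := TT x; rewrite xE.
rewrite (@direct_sum_component _ _ _ _ _ subK g s directK) -?xE //.
  rewrite big_seq_cond; apply: submodule_sum => // p /andP[/sP[_ _ Sp] /eqP].
  exact: Sp.
by move=> p /sP[].
Qed.

Lemma covering_coroot c : nzroot R c -> exists e h,
  [/\ Kg c e, Kg (- c) h & forall g x (m : int), root_lattice R g -> Kg g x ->
    cr c g = m%:~R -> bracket (bracket h e) x = x *~ m].
Proof.
move=> Rc; have [_ _ /(_ c Rc)[e0 [h0 [Le Lh heE]]] _] := gradL.
have [e Ke fe] := covering_surj (root_lattice_root Rc.1) Le.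
have [h Kh fh] := covering_surj (root_lattice_root (root_opp Rc.1)) Lh.
have fB x y : f (bracket x y) = bracket (f x) (f y).
  by case: covf => _ [].
exists e, h; split=> // g x m Qg Kx gm.
pose S := [set x | bracket (bracket h e) x = x *~ m].
have subS : is_submodule S.
  split; rewrite /S /=; first by rewrite linear0 mul0rz.
    by move=> y z /= yE zE; rewrite linearD /= yE zE mulrzDl.
  by move=> d y /= yE; rewrite linearZ /= yE scalerMzr.
suff : Kg g `<=` S by apply.
apply: covering_ind => // a b y z Ra Rb Ky Kz abg.
have [m1 am1] := root_int Rc.1 Ra; have [m2 bm2] := root_int Rc.1 Rb.
rewrite /S /=; have -> : m = m1 + m2.
  apply: (intr_char0_inj charF).
  by rewrite -gm -abg linearD am1 bm2 rmorphD.
(* The lift acts on K_d, for a root d, as the scalar n only up to an element of the kernel. That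
   error is central, so one more bracket removes it; this suffices because only brackets [K_a, K_b]
   have to be treated. *)
have heK d w n v : inR d -> Kg d w -> cr c d = n%:~R ->
    bracket (bracket (bracket h e) w) v = bracket w v *~ n.
  move=> Rd Kw dn; rewrite -bracketMzl -[X in bracket X v](subrK (w *~ n)).
  rewrite bracketDl covering_central ?add0r // linearB raddfMz !fB fe fh.
  by rewrite (heE d (f w) n Rd (covering_degree Kw) dn) subrr.
rewrite bracketA (heK _ _ _ _ Ra Ky am1) [bracket y (bracket _ _)]bracketC.
by rewrite (heK _ _ _ _ Rb Kz bm2) [bracket z y]bracketC mulNrz opprK mulrzDr.
Qed.

Lemma root_lattice_int g a : root_lattice R g -> inR a ->
  exists m : int, cr a g = m%:~R.
Proof.
move=> [n [v [c [Rv ->]]]] Ra; rewrite linear_sum /=.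
elim/big_rec: _ => [|i x _ [m ->]]; first by exists 0.
have [l lE] := root_int Ra (Rv i).
by exists (l * c i + m); rewrite raddfMz /= lE rmorphD rmorphM /= -mulrzr.
Qed.

Lemma covering_kernel_pairing g x c (m : int) : root_lattice R g -> Kg g x ->
  f x = 0 -> nzroot R c -> cr c g = m%:~R -> x *~ m = 0.
Proof.
move=> Qg Kx fx Rc gm; have [e [h [_ _ heE]]] := covering_coroot Rc.
by rewrite -(heE g x m) // bracketC covering_central ?oppr0.
Qed.

(** A nonzero pairing m bounds the common divisors of the pairings by |m|, so a largest one exists
    and [divisor] does not fall back on its default 0. *)
Lemma divisorP g : root_lattice R g -> (exists2 c, nzroot R c & cr c g <> 0) ->
  [/\ (0 < divisor R g)%N, divides_root R g (divisor R g)
    & forall n, (0 < n)%N -> divides_root R g n -> (n <= divisor R g)%N].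
Proof.
move=> Qg [c Rc cg].
pose P n := `[< (0 < n)%N /\ divides_root R g n >].
have P1 : exists n, P n.
  exists 1%N; apply/asboolP; split=> // a Ra.
  by have [m mE] := root_lattice_int Qg Ra; exists m; rewrite mul1r.
have [m mE] := root_lattice_int Qg Rc.1.
have m0 : (0 < `|m|)%N.
  by rewrite absz_gt0; apply/eqP => m0; apply: cg; rewrite mE m0.
have Pm n : P n -> (n <= `|m|)%N.
  move=> /asboolP[_ /(_ c Rc.1)[l lE]]; apply: dvdn_leq => //.
  move: lE; rewrite mE => /(intr_char0_inj charF)->.
  by rewrite abszM dvdn_mulr.
case: (ex_maxnP P1 Pm) => d /asboolP[d0 dg] dmax.
rewrite /divisor; apply: (@xgetPex _ 0%N [set n | [/\ (0 < n)%N, divides_root R g n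
    & forall n', (0 < n')%N -> divides_root R g n' -> (n' <= n)%N]]).
by exists d; split=> // n n0 ng; apply: dmax; apply/asboolP.
Qed.

(** The additive order n of [x] divides every pairing of [g], hence so does its least common
    multiple with the divisor. Since the divisor is the largest common divisor, this multiple equals
    it, and n divides it. *)
Lemma covering_kernel_divisor g x : root_lattice R g -> Kg g x -> f x = 0 ->
  (exists2 c, nzroot R c & cr c g <> 0) -> x *+ divisor R g = 0.
Proof.
move=> Qg Kx fx nz; have [d0 dg dmax] := divisorP Qg nz.
have [c Rc cg] := nz; have [m mE] := root_lattice_int Qg Rc.1.
have mul0 (n : int) : x *~ n = 0 -> x *+ `|n| = 0.
  case: (intP n) => [//|{}n|{}n] /=; first by [].
  by rewrite mulrNz => /eqP; rewrite oppr_eq0 => /eqP.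
pose P n := (0 < n)%N && (x *+ n == 0).
have exP : exists n, P n.
  exists `|m|%N; rewrite /P absz_gt0 (mul0 m) ?eqxx ?andbT.
    by apply/eqP => m0; apply: cg; rewrite mE m0.
  exact: covering_kernel_pairing mE.
case: (ex_minnP exP) => n /andP[n0 /eqP xn] nmin.
have ndiv l : x *+ l = 0 -> (n %| l)%N.
  move=> xl; rewrite /dvdn; apply: contraT; rewrite -lt0n => r0.
  have : (n <= l %% n)%N.
    apply: nmin; rewrite /P r0 /=; move: xl.
    by rewrite {1}(divn_eq l n) mulrnDr mulnC mulrnA xn mul0rn add0r => ->.
  by rewrite leqNgt ltn_mod n0.
suff /dvdnP[q ->] : (n %| divisor R g)%N by rewrite mulnC mulrnA xn mul0rn.
have lcm_dvd : (lcmn n (divisor R g) <= divisor R g)%N.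
  apply: dmax; first by rewrite lcmn_gt0 n0.
  move=> a Ra; have [l lE] := dg a Ra.
  have [a0|/eqP a0] := eqVneq a 0.
    by exists 0; rewrite a0 coroot0 mulr0.
  have nl : (n %| `|((divisor R g)%:Z * l)%R|)%N.
    apply/ndiv/mul0; apply: covering_kernel_pairing lE => //.
  have : (lcmn n (divisor R g) %| `|((divisor R g)%:Z * l)%R|)%N.
    by rewrite dvdn_lcm nl abszM dvdn_mulr.
  rewrite -[X in (X %| _)%N]absz_nat -dvdzE => /dvdzP[q qE].
  by exists q; rewrite lE qE mulrC.
have -> : divisor R g = lcmn n (divisor R g).
  by apply/eqP; rewrite eqn_leq lcm_dvd dvdn_leq ?lcmn_gt0 ?n0 ?dvdn_lcmr.
exact: dvdn_lcml.
Qed.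

(** * Removing the 2-torsion in degrees g and 2 g for a root g *)

Hypotheses (irrR : irreducible R) (redR : reduced R).
Hypothesis half : is_typeC R -> exists c : k, 2%:R * c = 1.

(** The hypotheses are shaped to serve both for [x] of degree [g] and for [x] of degree 2 g; in the
    latter case 4 is the pairing of 2 g with the coroot of [g], and [g], [- g] escape the bracket
    computation. If all pairings of [g] are even, type C provides 1/2. Otherwise an odd pairing 2 q
    + 1 comes from a root other than [g] and [- g], and doubling (2 q + 1) x = 0 gives 2 x = 0, then
    x = 0. *)
Lemma two_torsion_eq0 (g : E) (x : K) : nzroot R g -> x *+ 4 = 0 ->
  (forall b (m : int), nzroot R b -> b <> g -> b <> - g -> cr b g = m%:~R ->
     x *~ m = 0) ->
  x = 0.
Proof.
move=> Rg x4 xodd; have [g2|ng2] := pselect (divides_root R g 2).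
  have [c cE] := half (evenroot_typeC charF redR irrR (ex_intro _ g (conj Rg g2))).
  have x1 (y : K) : y = c *: (y *+ 2).
    by rewrite -scaler_nat scalerA mulrC cE scale1r.
  by rewrite (x1 x) (x1 (x *+ 2)) -mulrnA x4 !scaler0.
have [b Rb nb] : exists2 b, inR b & ~ exists m : int, cr b g = (2%:Z * m)%:~R.
  apply: contrapT => nb; apply: ng2 => b Rb; apply: contrapT => nm.
  by apply: nb; exists b.
have [m mE] := root_int Rb Rg.1.
have [q mq] : exists q : int, m = 2 * q + 1.
  exists (m %/ 2)%Z; have m2 : m != 2 * (m %/ 2)%Z.
    by apply/eqP => m2; apply: nb; exists (m %/ 2)%Z; rewrite -m2.
  lia.
have bg : b <> g.
  by move=> bg; apply: nb; exists 1; rewrite bg nzroot_pairing2.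
have bNg : b <> - g.
  move=> bE; apply: nb; exists (-1); have := nzroot_pairing2 (nzroot_opp Rg).
  by rewrite -bE => b2; rewrite -[g]opprK -bE linearN /= b2 mulrN1 rmorphN.
have b0 : b <> 0.
  by move=> b0; apply: nb; exists 0; rewrite b0 coroot0 mulr0.
have xm : x *~ m = 0 by apply: xodd mE.
have x2 : x *+ 2 = 0.
  have : x *~ m *+ 2 = 0 by rewrite xm mul0rn.
  rewrite mq mulrzDr mulrnDl mulr1z pmulrn -mulrzA.
  have -> : 2 * q * 2 = 4 * q by ring.
  by rewrite mulrzA -pmulrn x4 mul0rz add0r.
by move: xm; rewrite mq mulrzDr mulrzA -pmulrn x2 mul0rz add0r.
Qed.

Lemma covering_root_inj g x : nzroot R g -> Kg g x -> f x = 0 -> x = 0.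
Proof.
move=> Rg Kx fx; have Qg := root_lattice_root Rg.1.
apply: (two_torsion_eq0 Rg) => [|b m Rb _ _ bg].
  have : x *~ 2 = 0.
    exact: (@covering_kernel_pairing g x g 2 Qg Kx fx Rg (nzroot_pairing2 Rg)).
  by rewrite -pmulrn => x2; rewrite (mulrnA x 2 2) x2 mul0rn.
exact: covering_kernel_pairing bg.
Qed.

(* If [g = 2 a] is not a sum of independent roots, then for [c] independent of
   [a] at most one of [a + c], [a - c] is a root, and [2 a + c] is not one. *)
Lemma covering_independent_sum g x : g <> 0 -> root_lattice R g -> ~ inR g ->
  Kg g x -> x <> 0 ->
  exists a b, [/\ nzroot R a, nzroot R b, b <> a, b <> - a & g = a + b].
Proof.
move=> g0 Qg nRg Kx x0; apply: contrapT => noindep.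
have dep a b : inR a -> inR b -> a + b = g -> b = a.
  move=> Ra Rb abg; apply: contrapT => ba; apply: noindep.
  exists a, b; split=> //.
  - by split=> // a0; apply: nRg; rewrite -abg a0 add0r.
  - by split=> // b0; apply: nRg; rewrite -abg b0 addr0.
  - by move=> bNa; apply: g0; rewrite -abg bNa subrr.
apply: x0; have sub0 : is_submodule [set (0 : K)].
  split=> //= [y z -> ->|c y ->]; [exact: addr0|exact: scaler0].
suff : Kg g `<=` [set 0] by apply.
apply: covering_ind => // a b y z Ra Rb Ky; have [->|/eqP ba] := eqVneq b a; last first.
  by move=> _ abg; case: ba; apply: dep.
move=> Kz ag {b Rb} /=.
have nza : nzroot R a by split=> // a0; apply: nRg; rewrite -ag a0 addr0; apply: Defs.root0.
have fyz : f (bracket y z) = 0.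
  by apply: (covering_nonroot nRg); rewrite -ag; apply: Kg_bracket.
have double (u v : E) : u + u = v + v -> u = v.
  rewrite -!mulr2n => /eqP; rewrite -subr_eq0 -mulrnBl -scaler_nat scaler_eq0.
  by rewrite ((pcharf0P _).1 charF) /= subr_eq0 => /eqP.
(* By Jacobi this is [u, [w, z]] - [w, [u, z]], and a factor of non-root degree is central. The root
   facts come from the splittings 2 a = (2 a + c) + (- c) = (a + c) + (a - c), whose two terms would
   have to be equal. *)
have vanish c u w : nzroot R c -> c <> a -> c <> - a -> Kg (- c) u -> Kg (a + c) w ->
    bracket (bracket u w) z = 0.
  move=> Rc ca cNa Ku Kw; rewrite bracket_bracketl.
  have nR2 : ~ inR (a + c + a).
    move=> Rs; have cE : - c = a + c + a.
      by apply: dep (root_opp Rc.1) _ => //; rewrite addrAC addrK.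
    apply: cNa; have /eqP : a + c = 0 by apply: double; rewrite !addr0 addrA -cE addNr.
    by rewrite addrC addr_eq0 => /eqP.
  rewrite bracketC (covering_central _ (covering_nonroot nR2 (Kg_bracket Kw Kz))).
  rewrite oppr0 sub0r; apply/eqP; rewrite oppr_eq0; apply/eqP.
  have [Rp|nRp] := pselect (inR (a + c)); last first.
    by rewrite covering_central // (covering_nonroot nRp Kw).
  have [Rm|nRm] := pselect (inR (- c + a)); last first.
    by rewrite bracketC covering_central ?oppr0 // (covering_nonroot nRm (Kg_bracket Ku Kz)).
  have := dep _ _ Rp Rm; rewrite addrA addrK => /(_ ag).
  rewrite addrC => /addrI cE; case: Rc.2; apply: double.
  by rewrite addr0 -{1}cE addNr.
apply: (two_torsion_eq0 nza).
  apply: (covering_kernel_pairing Qg _ fyz nza (m := 4)).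
    by rewrite -ag; apply: Kg_bracket.
  by rewrite -ag linearD /= nzroot_pairing2 // -natrD.
(* The lift acts on the factor [y], of degree [a], so the integer obtained is [m] and not 2 m.
   Expanding its action as the commutator of the actions of [h] and [e] leaves two terms covered by
   [vanish], for [b] and for [- b]. *)
move=> b m Rb ba bNa bm.
have [e [h [Ke Kh heE]]] := covering_coroot Rb.
rewrite -bracketMzl -(heE a y m (root_lattice_root Ra) Ky bm).
have -> : bracket (bracket h e) y =
    bracket h (bracket e y) - bracket e (bracket h y).
  exact: bracket_bracketl.
rewrite bracketDl -scaleN1r bracketZl (vanish b) //; last first.
  by rewrite addrC; apply: Kg_bracket.
rewrite add0r (vanish (- b)) ?scaler0 ?opprK //; first exact: nzroot_opp.
- by move=> bNa'; apply: bNa; rewrite -bNa' opprK.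
- by move/oppr_inj.
- by rewrite addrC; apply: Kg_bracket.
Qed.

End Covering.

(** * The dichotomy for degrees in the support *)

Theorem proposition5p2p18
  (F : fieldType) (charF : [pchar F] =i pred0)
  (E : lmodType F) (R : rootSystem E)
  (irrR : irreducible R) (redR : reduced R)
  (k : comPzRingType)
  (half : is_typeC R -> exists c : k, 2%:R * c = 1)
  (L : lieAlgType k) (Lg : E -> set L) (gradL : root_graded R Lg)
  (K : lieAlgType k) (Kg : E -> set K) (f : {linear K -> L})
  (covf : graded_central_covering R Kg Lg f)
  (g : E) (g_neq0 : g <> 0) (g_supp : supp R Kg g) :
  (nzroot R g /\ set_bij (Kg g) (Lg g) f)
  \/
  [/\ ~ nzroot R g, degenerate_sum R g, Kg g `<=` f @^-1` [set 0]
    & forall x, Kg g x -> x *+ divisor R g = 0].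
Proof.
have [Qg Kg0] := g_supp.
have [[subK _ _ _] _ _ _ _] := covf.
have [x Kx x0] : exists2 x, Kg g x & x <> 0.
  apply: contrapT => nx; apply: Kg0; apply/seteqP; split=> x.
    by move=> Kx; apply: contrapT => x0; apply: nx; exists x.
  by move=> ->; case: (subK g).
have [Rg|nRg] := pselect (rs_roots R g); [left|right].
  split=> //; split.
  - by move=> y Ky; apply: (covering_degree covf).
  - move=> y z; rewrite !inE => Ky Kz fyz; apply/eqP; rewrite -subr_eq0; apply/eqP.
    apply: (covering_root_inj charF gradL covf irrR redR half (conj Rg g_neq0)).
      by case: (subK g) => _ KD _; apply: KD => //; apply: submodule_opp.
    by rewrite linearB fyz subrr.
  - move=> y Ly; have [z Kz zy] := covering_surj gradL covf Qg Ly.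
    by exists z.
have [a [b [Ra Rb ba bNa gE]]] :=
  covering_independent_sum charF gradL covf irrR redR half g_neq0 Qg nRg Kx x0.
have nz : exists2 c, nzroot R c & coroot R c g <> 0.
  by rewrite gE; apply: root_sum_pairing.
have torsion y : Kg g y -> y *+ divisor R g = 0.
  move=> Ky; apply: (covering_kernel_divisor charF gradL covf) => //.
  exact: (covering_nonroot gradL covf nRg).
split=> //; first by case.
- split.
    exists a, b; split=> //; [exact: Ra.1|exact: Rb.1|].
    exact: (root_lin_indep charF redR).
  have [d0 _ _] := divisorP charF Qg nz.
  (* Divisor 1 would kill the nonzero element [x]. *)
  have := torsion x Kx; case: (divisor R g) d0 => [//|[|n]] //= _.
- by move=> y Ky; apply: (covering_nonroot gradL covf nRg).
Qed.
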